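(* Let $Y$ be a metrizable space containing at least two points, and let $X$ be a $Y_{\mathcal I}$-Tychonoff space for some ideal $\mathcal I$ of compact sets of $X$. Then the following statements are equivalent: (i) $C_{\mathcal I}(X,Y)$ is a Fréchet–Urysohn space; (ii) $C_{\mathcal I}(X,Y)^\omega$ is a Fréchet–Urysohn space; (iii) $C_{\mathcal I}(X,Y^\omega)$ is a Fréchet–Urysohn space; (iv) $X$ has the property $\gamma_{\mathcal I}$.
   Context: An ideal of compact sets of a topological space $X$ is a family $\mathcal I$ of compact subsets of $X$ with $\bigcup\mathcal I=X$ such that for all $A,B\in\mathcal I$ and every compact $K\subseteq X$ one has $A\cup B\in\mathcal I$ and $A\cap K\in\mathcal I$. $C_{\mathcal I}(X,Y)$ is the set $C(X,Y)$ of all continuous functions $X\to Y$ with the $\mathcal I$-open topology, whose subbase consists of the sets $\{f: f(K)\subseteq U\}$ with $K\in\mathcal I$ and $U\subseteq Y$ open. Powers $Y^\omega$ and $C_{\mathcal I}(X,Y)^\omega$ carry the product topology. $X$ is $Y_{\mathcal I}$-Tychonoff if for every closed $A\subseteq X$, every point $y_0\in Y$, every $F\in\mathcal I$ with $F\subseteq X\setminus A$, and every continuous $f:F\to Y$ with finite image there is a continuous $\bar f:X\to Y$ with $\bar f|_F=f$ and $\bar f(A)\subseteq\{y_0\}$. A family $\gamma$ of subsets of $X$ is an $\mathcal I$-cover if every $A\in\mathcal I$ is contained in some $U\in\gamma$; it is open if all its members are open. An $\mathcal I$-sequence is a sequence $\{C_n\}_{n\in\omega}$ (repetitions allowed) of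 subsets of $X$ such that for every $A\in\mathcal I$ there is $m$ with $A\subseteq C_n$ for all $n\ge m$. $X$ has the property $\gamma_{\mathcal I}$ if every open $\mathcal I$-cover of $X$ contains an $\mathcal I$-sequence (i.e. there is an $\mathcal I$-sequence all of whose terms are members of the cover). A space is Fréchet–Urysohn if whenever $a\in\overline A$ there is a sequence in $A$ converging to $a$. *)

(* Defs.v *)
From HB Require Import structures.
From mathcomp Require Import all_boot all_order all_algebra.
From mathcomp Require Import all_classical all_reals all_analysis.

Set Implicit Arguments.
Unset Strict Implicit.
Unset Printing Implicit Defensive.

Import Order.TTheory GRing.Theory Num.Theory.

Local Open Scope classical_set_scope.
Local Open Scope ring_scope.

Definition metrizable (R : realType) (Y : topologicalType) : Prop :=
  exists d : Y -> Y -> R,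
    [/\ forall x y, 0 <= d x y,
        forall x y, d x y = 0 <-> x = y,
        forall x y, d x y = d y x,
        forall x y z, d x z <= d x y + d y z &
        forall x (A : set Y),
          nbhs x A <-> exists2 e : R, 0 < e & [set y | d x y < e] `<=` A].

(* The clause [I !=set0] follows from the covering clause as soon as [X] is
   inhabited; it only rules out the empty family on the empty space, whose
   empty cover contains no sequence at all. *)
Definition compact_ideal (X : topologicalType) (I : set (set X)) : Prop :=
  [/\ I !=set0,
      forall A, I A -> compact A,
      \bigcup_(A in I) A = [set: X],
      forall A B, I A -> I B -> I (A `|` B) &
      forall A K, I A -> compact K -> I (A `&` K)].

Definition ideal_open (X Y : topologicalType) (I : set (set X)) : Type :=
  continuousType X Y.

Section IdealOpen.
Variables (X Y : topologicalType) (I : set (set X)).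

Definition ideal_open_subbase : set (set (ideal_open Y I)) :=
  [set W | exists K (U : set Y), [/\ I K, open U &
     W = [set f | (f : continuousType X Y) @` K `<=` U]]].

HB.instance Definition _ := Choice.on (ideal_open Y I).
HB.instance Definition _ :=
  isSubBaseTopological.Build (ideal_open Y I) ideal_open_subbase id.

End IdealOpen.

(* A map [F -> Y] is encoded by a total [f : X -> Y] of which only the
   restriction to [F] matters; nothing is lost since [Y] contains [y0]. *)
Definition ideal_Tychonoff (X Y : topologicalType) (I : set (set X)) : Prop :=
  forall (A : set X) (y0 : Y) (F : set X) (f : X -> Y),
    closed A -> I F -> F `<=` ~` A ->
    {within F, continuous f} -> finite_set (f @` F) ->
    exists g : X -> Y,
      [/\ continuous g, forall x, F x -> g x = f x & g @` A `<=` [set y0]].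

Definition ideal_cover (X : Type) (I gamma : set (set X)) : Prop :=
  forall A, I A -> exists2 U, gamma U & A `<=` U.

Definition ideal_sequence (X : Type) (I : set (set X)) (C : nat -> set X) :
    Prop :=
  forall A, I A -> exists m, forall n, (m <= n)%N -> A `<=` C n.

Definition gamma_property (X : topologicalType) (I : set (set X)) : Prop :=
  forall gamma : set (set X),
    (forall U, gamma U -> open U) -> ideal_cover I gamma ->
    exists2 C : nat -> set X, forall n, gamma (C n) & ideal_sequence I C.

Definition frechet_urysohn (T : topologicalType) : Prop :=
  forall (A : set T) (a : T), closure A a ->
    exists2 u : nat -> T, forall n, A (u n) & u @ \oo --> a.

(* Main.v *)
Require Import Defs.
From HB Require Import structures.
From mathcomp Require Import all_boot all_order all_algebra.
From mathcomp Require Import all_classical all_reals all_analysis.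
From mathcomp Require Import lra.

(** The equivalence rests on two implications, each proved for functions into
    one space [Z] and then used for both [Z = Y] and [Z = Y^omega].

    A metrizable space has a countable base of entourages, and so has its
    countable power ([metrizable_gauge], [product_gaugeP]). For such a [Z] the
    ideal-open topology is that of uniform convergence on the members of the
    ideal ([ideal_open_uniform_cvgP]). If [f] is in the closure of [A], then at
    each level [n] the open sets where some [g] in [A] is close to [f] form an
    ideal cover, and the gamma property extracts from these covers a sequence
    of functions in [A]. The extraction mixes all the levels in one cover, and
    the delicate point is to make the levels tend to infinity: intersecting the
    members of level [n] with the [n]-th term of an ideal sequence of proper
    subsets of [X] prevents a level from occurring infinitely often. Hence the
    gamma property makes the function space Fréchet-Urysohn
    ([gamma_frechet_urysohn]).

    Conversely, a constant function [z1] is in the closure of the functions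
    that take a different value [z2] off some member of a given cover, by the
    Tychonoff hypothesis; the members attached to a sequence of such functions
    converging to [z1] form an ideal sequence ([frechet_urysohn_gamma]).

    Finally, the power of the function space is homeomorphic to the space of
    functions into the power ([tuple_map_continuous],
    [coordinate_maps_continuous]), so the two are Fréchet-Urysohn together. *)

Set Implicit Arguments.
Unset Strict Implicit.
Unset Printing Implicit Defensive.

Import Order.TTheory GRing.Theory Num.Theory.

Local Open Scope classical_set_scope.
Local Open Scope ring_scope.

(** * Countable uniform bases *)

Section Gauge.
Variables (Z : topologicalType) (E : nat -> Z -> Z -> Prop).

(** A decreasing countable base of symmetric entourages, each containing the
    composite square of the next: what remains of a metric once distances are
    forgotten. Metrizable spaces carry one, and unlike a metric it passes to
    countable products with no rescaling or summation. *)
Definition uniform_gauge : Prop :=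
  [/\ forall n z, E n z z,
      forall n y z, E n y z -> E n z y,
      forall n x y z, E n.+1 x y -> E n.+1 y z -> E n x z &
      forall z (A : set Z), nbhs z A <-> exists n, [set y | E n z y] `<=` A].

Hypothesis gE : uniform_gauge.

Lemma gauge_refl n z : E n z z. Proof. by case: gE. Qed.

Lemma gauge_sym n y z : E n y z -> E n z y.
Proof. by case: gE => _ + _ _; apply. Qed.

Lemma gauge_trans n y x z : E n.+1 x y -> E n.+1 y z -> E n x z.
Proof. by case: gE => _ _ + _; apply. Qed.

Lemma gauge_le m n y z : (m <= n)%N -> E n y z -> E m y z.
Proof.
move=> /subnK <-; elim: (n - m)%N => // k IH h; apply: IH.
exact: gauge_trans h (gauge_refl _ _).
Qed.

Lemma nbhs_gauge n z : nbhs z [set y | E n z y].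
Proof. by case: gE => _ _ _ /(_ z) ->; exists n. Qed.

Lemma gauge_nbhs z A : nbhs z A -> exists n, [set y | E n z y] `<=` A.
Proof. by case: gE => _ _ _ /(_ z) ->. Qed.

Lemma gauge_interior n y z : E n.+1 z y -> interior [set y | E n z y] y.
Proof.
by move=> zy; apply: filterS (nbhs_gauge n.+1 y) => w; exact: gauge_trans.
Qed.

Lemma gauge_closure n y z : closure [set y | E n.+1 z y] y -> E n z y.
Proof.
move=> /(_ _ (nbhs_gauge n.+1 y)) [w [zw /gauge_sym]]; exact: gauge_trans.
Qed.

(** The cover that decides the Fréchet-Urysohn property is made of these
    interiors. Two levels are lost because [f] and [g] both move when [x]
    does. *)
Lemma gauge_open_agreement (X : topologicalType) (f g : X -> Z) n x :
  continuous f -> continuous g ->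
  E n.+2 (f x) (g x) -> interior [set y | E n (f y) (g y)] x.
Proof.
move=> cf cg fgx; near=> y.
apply: (@gauge_trans _ (g x)).
  apply: (@gauge_trans _ (f x)) => //; apply: gauge_sym; near: y.
  exact: cf (nbhs_gauge _ _).
by near: y; exact: cg (nbhs_gauge _ _).
Unshelve. all: by end_near. Qed.

End Gauge.

Lemma metrizable_gauge (R : realType) (Y : topologicalType) :
  metrizable R Y -> exists E : nat -> Y -> Y -> Prop, uniform_gauge E.
Proof.
move=> [d [d0 deq dsym dtri dnbhs]].
exists (fun n x y => d x y < 2^-1 ^+ n); split.
- by move=> n z; rewrite (deq z z).2// exprn_gt0.
- by move=> n y z; rewrite dsym.
- move=> n x y z; rewrite exprS => xy yz.
  by apply: le_lt_trans (dtri x y z) _; lra.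
move=> z A; rewrite dnbhs; split=> [[e e0 eA]|[n nA]]; last first.
  by exists (2^-1 ^+ n) => //; rewrite exprn_gt0.
have := @cvg_geometric R 1 2^-1.
rewrite ger0_norm// invf_lt1// ltr1n => /(_ isT) /cvgr0Pnorm_lt /(_ e e0).
move=> [n _ /(_ n (leqnn _))] /=; rewrite mul1r ger0_norm// => ne.
by exists n => y /= /lt_trans h; apply: eA; exact: h.
Qed.

(** * Countable products *)

Lemma product_cvgP (T : nat -> topologicalType)
    (F : set_system (prod_topology T)) (u : prod_topology T) : Filter F ->
  F --> u <-> forall i (A : set (T i)), nbhs (u i) A -> F [set v | A (v i)].
Proof.
move=> FF; split=> [Fu i A uA|h].
  by apply: Fu; apply: (@proj_continuous _ T i u _ uA).
apply/cvg_sup => i A /= [_ [[B oB <-] Bu BA]].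
by apply: filterS BA _; apply: h; exact: open_nbhs_nbhs.
Qed.

Lemma continuous_tuple (S : topologicalType) (T : nat -> topologicalType)
    (f : S -> prod_topology T) :
  (forall i, continuous (fun x => f x i)) -> continuous f.
Proof.
move=> cf x; apply/product_cvgP => i A; exact: cf.
Qed.

(** Level [n] constrains only the coordinates up to [n]: each level is then a
    neighbourhood in the product topology, and a neighbourhood given by
    coordinate [i] and level [n] of [E] contains level [maxn i n]. *)
Definition product_gauge (Y : Type) (E : nat -> Y -> Y -> Prop) (n : nat)
    (u v : nat -> Y) : Prop :=
  forall i, (i <= n)%N -> E n (u i) (v i).

Section ProductGauge.
Variables (Y : topologicalType) (E : nat -> Y -> Y -> Prop).
Hypothesis gE : uniform_gauge E.

Lemma product_gaugeP :
  @uniform_gauge (prod_topology (fun _ : nat => Y)) (product_gauge E).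
Proof.
split.
- by move=> n u i _; exact: gauge_refl.
- by move=> n u v uv i /uv; exact: gauge_sym.
- move=> n u v w uv vw i ni.
  by apply: (gauge_trans gE) (uv i _) (vw i _); exact: leq_trans ni _.
move=> u A; split=> [uA|[n nA]].
  (* It is enough that the filter of boxes converges to [u], which is tested
     one coordinate at a time. *)
  pose F := filter_from [set: nat] (fun n => [set v | product_gauge E n u v]).
  have FF : Filter F.
    apply: filter_from_filter; first by exists 0%N.
    move=> m n _ _; exists (maxn m n) => // v uv; split=> i ii.
      by apply: (gauge_le gE (leq_maxl m n)); apply: uv;
        exact: leq_trans ii (leq_maxl _ _).
    by apply: (gauge_le gE (leq_maxr m n)); apply: uv;
      exact: leq_trans ii (leq_maxr _ _).
  have Fu : F --> (u : prod_topology (fun _ : nat => Y)).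
    apply/product_cvgP => i B /(gauge_nbhs gE) [n nB].
    exists (maxn i n) => // v uv; apply: nB.
    by apply: (gauge_le gE (leq_maxr i n)); apply: uv; exact: leq_maxl.
  by have [n _ nA] := Fu _ uA; exists n.
have FFu : Filter (nbhs (u : prod_topology (fun _ : nat => Y))).
  exact: nbhs_filter.
apply: filterS nA _.
(* Counting coordinates strictly below [m] makes the induction start from the
   empty constraint. *)
suff: forall m, nbhs (u : prod_topology (fun _ : nat => Y))
    [set v | forall i, (i < m)%N -> E n (u i) (v i)] by move=> /(_ n.+1).
elim=> [|m IH]; first by apply: filterS filterT => v.
have um : nbhs (u : prod_topology (fun _ : nat => Y)) [set v | E n (u m) (v m)].
  apply: (@proj_continuous _ (fun _ : nat => Y) m u); exact: nbhs_gauge.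
apply: filterS2 IH um => v uv uvm i; rewrite ltnS leq_eqVlt => /predU1P[->//|].
exact: uv.
Qed.

End ProductGauge.

(** * The ideal-open topology as uniform convergence *)

Definition ideal_fun (X Z : topologicalType) (I : set (set X))
    (f : ideal_open Z I) : X -> Z :=
  (f : continuousType X Z).

Coercion ideal_fun : ideal_open >-> Funclass.

Lemma ideal_cts (X Z : topologicalType) (I : set (set X)) (f : ideal_open Z I) :
  continuous f.
Proof. exact: (@cts_fun _ _ (f : continuousType X Z)). Qed.

Section IdealOpenTopology.
Variables (X Z : topologicalType) (I : set (set X)).
Local Notation CI := (ideal_open Z I).

Definition ideal_mkcts (f : X -> Z) (cf : continuous f) : CI :=
  (mkcts cf : continuousType X Z).

Lemma ideal_open_cvgP (F : set_system CI) (f : CI) : Filter F ->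
  F --> f <-> forall K (U : set Z), I K -> open U ->
    (f : X -> Z) @` K `<=` U -> F [set g | (g : X -> Z) @` K `<=` U].
Proof.
move=> FF; split=> [Ff K U IK oU fKU|h A].
  apply: Ff; exists [set g : CI | (g : X -> Z) @` K `<=` U].
  split=> //; exists [set [set g : CI | (g : X -> Z) @` K `<=` U]].
    move=> _ ->; apply: finI_from1; exists K, U; split=> //.
  by rewrite bigcup_set1.
move=> [_ [[B sB <-] [C BC Cf] sA]].
apply: (filterS sA); apply: (@filterS _ _ _ C); first by move=> g Cg; exists C.
have [D sD DC] := sB _ BC; rewrite -DC; apply: filter_bigI => W DW.
have := sD _ DW; rewrite inE => -[K [U [IK oU WE]]].
rewrite WE; apply: h => //; move: Cf; rewrite -DC => /(_ _ DW).
by rewrite /= WE.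
Qed.

Hypothesis hI : compact_ideal I.

(** A basic neighbourhood of [f] constrains values on finitely many members of
    the ideal, and their union is again a member. *)
Lemma ideal_open_nbhs_agree (f : CI) (B : set CI) : nbhs f B ->
  exists2 K, I K & forall g : CI,
    (forall x, K x -> g x = f x) -> B g.
Proof.
case: hI => I0 _ _ IU _.
pose agree K := [set g : CI | forall x, K x -> g x = f x].
have FF : Filter (filter_from I agree).
  apply: filter_from_filter => // K L IK IL; exists (K `|` L); first exact: IU.
  by move=> g gKL; split=> x Kx; apply: gKL; [left|right].
have Ff : filter_from I agree --> f.
  apply/ideal_open_cvgP => K U IK oU fKU; exists K => // g gf _ [x Kx <-].
  by rewrite gf//; apply: fKU; exists x.
by move=> /Ff [K IK KB]; exists K.
Qed.

Variable E : nat -> Z -> Z -> Prop.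
Hypothesis gE : uniform_gauge E.

(** The analogue for an ideal of the comparison of the compact-open topology
    with uniform convergence on compact sets. A member [K] has to be cut into
    smaller members on which [f] is nearly constant: its intersections with
    preimages of closed subsets of [Z] are compact whatever the separation
    properties of [X], and they are in the ideal because it is stable under
    intersection with compact sets. Both directions then pass from points to
    [K] by the near-covering form of compactness. *)
Lemma ideal_open_uniform_cvgP (F : set_system CI) (f : CI) : Filter F ->
  F --> f <-> forall K n, I K ->
    F [set g | forall x, K x -> E n (f x) (g x)].
Proof.
case: hI => _ Ic _ _ IK' FF; have cf : continuous f := @ideal_cts _ _ _ f.
split=> [/ideal_open_cvgP Ff K n IK|h].
- have /compact_near_coveringP/near_covering_withinP := Ic _ IK.
  apply=> x Kx.
  (* [f] maps the piece [K `&` C] into [U]; any [g] doing the same is close to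
     [f] on it, and the piece contains all points of [K] near [x]. One level is
     spent on the closure, one on the interior, one on the final triangle
     inequality at [f x]. *)
  pose C := (f : X -> Z) @^-1` closure [set z | E n.+3 (f x) z].
  pose U := interior [set z | E n.+1 (f x) z].
  have IKC : I (K `&` C).
    rewrite -[K]setIid -setIA; apply: (IK') => //.
    apply: compact_closedI; first exact: Ic.
    by apply: (continuous_closedP _).1 => //; exact: closed_closure.
  have fU : (f : X -> Z) @` (K `&` C) `<=` U.
    move=> _ [z [Kz Cz] <-]; apply: (gauge_interior gE).
    exact: (gauge_closure gE).
  have FW := Ff _ _ IKC (open_interior _) fU.
  exists ([set z | E n.+3 (f x) (f z)],
          [set g : CI | (g : X -> Z) @` (K `&` C) `<=` U]).
    split=> //=; exact: (cf x _ (nbhs_gauge gE _ _)).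
  move=> [z g] /= [xz gU] Kz.
  have gz : E n.+1 (f x) (g z).
    apply: (@interior_subset _ [set z | E n.+1 _ z]); apply: gU; exists z => //.
    by split=> //; exact: subset_closure.
  apply: (gauge_trans gE) _ gz; apply: (gauge_sym gE).
  exact: (gauge_le gE (ltnW (leqnSn _)) xz).
- apply/ideal_open_cvgP => K U IK oU fKU.
  (* A compact set inside an open set has a uniform margin. *)
  suff [n nU] : exists n, forall x, K x -> forall z, E n (f x) z -> U z.
    by apply: filterS (h K n IK) => g gf _ [x Kx <-]; exact: nU (gf x Kx).
  have /compact_near_coveringP/near_covering_withinP := Ic _ IK.
  move=> /(_ nat \oo (fun n x => forall z, E n (f x) z -> U z) _).
  case=> [x Kx|n _ nU]; last by exists n => x; apply: (nU n (leqnn n)).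
  have /(gauge_nbhs gE) [m mU] : nbhs (f x) U.
    by apply: open_nbhs_nbhs; split=> //; apply: fKU; exists x.
  exists ([set z | E m.+1 (f x) (f z)], [set n | (m.+1 <= n)%N]).
    split; first exact: (cf x _ (nbhs_gauge gE _ _)).
    by exists m.+1.
  move=> [y n] /= [xy mn] Ky z yz; apply: mU.
  by apply: (gauge_trans gE) xy _; exact: (gauge_le gE mn yz).
Qed.

End IdealOpenTopology.

(** * The gamma property and Fréchet-Urysohn function spaces *)

Section GammaFrechet.
Variables (X Z : topologicalType) (I : set (set X)).
Variable E : nat -> Z -> Z -> Prop.
Hypotheses (gE : uniform_gauge E) (hI : compact_ideal I).

(** No index [m] can recur forever: a point missed by [G m] lies in a member of
    the ideal; for large [j] this member is contained in [V j], hence in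
    [G (k j)], so that [k j] is not [m]. *)
Lemma ideal_sequence_index_infty (G : nat -> set X) (V : nat -> set X)
    (k : nat -> nat) :
  (forall n, G n <> setT) -> ideal_sequence I V ->
  (forall j, V j `<=` G (k j)) ->
  forall m, exists N, forall j, (N <= j)%N -> (m <= k j)%N.
Proof.
case: hI => _ _ Icov _ _ GT Vseq VG; elim=> [|m [N mk]]; first by exists 0%N.
have [x Gx] : exists x, ~ G m x.
  apply: contrapT => h; apply: (GT m); apply/seteqP; split=> // x _.
  by apply: contrapT => Gx; apply: h; exists x.
have [B IB Bx] : (\bigcup_(A in I) A) x by rewrite Icov.
have [N' BV] := Vseq _ IB.
exists (maxn N N') => j; rewrite geq_max => /andP[Nj N'j].
rewrite ltn_neqAle mk// andbT; apply/eqP => mkj.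
by apply: Gx; rewrite mkj; apply: VG; exact: BV N'j _ Bx.
Qed.

(** Let [f] be in the closure of [A]. The sets [W n g], on which [g] in [A] is
    close to [f] at level [n], form an open cover for each [n]; an ideal
    sequence of sets [W (k j) (u j)] gives a sequence [u] converging to [f] as
    soon as the levels [k j] tend to infinity. To force this, members of level
    [n] are cut down by the [n]-th term of an auxiliary ideal sequence of
    proper subsets of [X]. Such a sequence may fail to exist when every level
    has a member equal to [X], but then these members give [u] directly. *)
Lemma gamma_frechet_urysohn :
  gamma_property I -> frechet_urysohn (ideal_open Z I).
Proof.
move=> gammaI A f clAf.
pose W n (g : ideal_open Z I) := interior [set x | E n (f x) (g x)].
have Wcov n K : I K -> exists2 g, A g & K `<=` W n g.
  move=> IK.
  have /(ideal_open_uniform_cvgP hI gE _ _).1 : nbhs f --> f by exact: cvg_id.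
  move=> /(_ K n.+2 IK) /clAf [g [Ag Kg]]; exists g => // x /Kg.
  exact: (gauge_open_agreement gE) (@ideal_cts _ _ _ f) (@ideal_cts _ _ _ g).
have cvgW (u : nat -> ideal_open Z I) (k : nat -> nat) :
    (forall m, exists N, forall j, (N <= j)%N -> (m <= k j)%N) ->
    ideal_sequence I (fun j => W (k j) (u j)) -> u @ \oo --> f.
  move=> kinf useq; apply/(ideal_open_uniform_cvgP hI gE) => K n IK.
  have [N kN] := kinf n; have [N' uN'] := useq _ IK.
  exists (maxn N N') => // j /=; rewrite geq_max => /andP[/kN nk /uN' KW] x Kx.
  by apply: (gauge_le gE nk); exact: interior_subset (KW x Kx).
(* Either the members of some level [n0] are all proper, and they supply the
   auxiliary sequence, or some function in [A] is close to [f] on all of [X] at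
   every level. *)
have [[n0 Wn0]|WT] := pselect (exists n, forall g, A g -> W n g <> setT).
  have [G GW Gseq] : exists2 G : nat -> set X, forall n, (W n0 @` A) (G n) &
      ideal_sequence I G.
    apply: gammaI => [_ [g _ <-]|K /(Wcov n0) [g Ag KW]].
      exact: open_interior.
    by exists (W n0 g) => //; exists g.
  have oG n : open (G n) by have [g _ <-] := GW n; exact: open_interior.
  pose gam := [set V | exists n g, A g /\ V = G n `&` W n g].
  have [V gV Vseq] : exists2 V : nat -> set X, forall n, gam (V n) &
      ideal_sequence I V.
    apply: gammaI => [_ [n [g [_ ->]]]|K IK].
      by apply: openI => //; exact: open_interior.
    have [n /(_ n (leqnn n)) KG] := Gseq _ IK; have [g Ag KW] := Wcov n _ IK.
    by exists (G n `&` W n g); [exists n, g | rewrite subsetI].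
  have [k /choice[u ukV]] := choice gV.
  exists u => [j|]; first by case: (ukV j).
  apply: (cvgW u k).
    apply: (ideal_sequence_index_infty (G := G) _ Vseq) => [n|j].
      by have [g Ag <-] := GW n; exact: Wn0.
    by have [_ ->] := ukV j.
  move=> K /Vseq [m mV]; exists m => j /mV.
  by have [_ ->] := ukV j; rewrite subsetI => -[].
have {}WT n : exists g, A g /\ W n g = setT.
  apply: contrapT => h; apply: WT; exists n => g Ag Wg; apply: h.
  by exists g.
have [u Wu] := choice WT.
exists u => [j|]; first by case: (Wu j).
apply: (cvgW u id) => [m|K _]; first by exists m.
by exists 0%N => j _; have [_ ->] := Wu j.
Qed.

End GammaFrechet.

(** Given a cover [gam], the constant function [z1] is in the closure of the
    set of functions equal to [z2] off some member of [gam]: agreement with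
    [z1] on one member [K] of the ideal can be combined with the value [z2] off
    a member of [gam] that contains [K]. If such functions [u n] converge to
    [z1], then on each [K] they eventually avoid [z2], so [K] lies in the
    members of [gam] attached to them. *)
Lemma frechet_urysohn_gamma (X Z : topologicalType) (I : set (set X))
    (z1 z2 : Z) (V : set Z) :
  compact_ideal I -> open V -> V z1 -> ~ V z2 ->
  (forall A F, closed A -> I F -> F `<=` ~` A ->
     exists g : X -> Z, [/\ continuous g, forall x, F x -> g x = z1 &
       forall x, A x -> g x = z2]) ->
  frechet_urysohn (ideal_open Z I) -> gamma_property I.
Proof.
move=> hI oV Vz1 Vz2 sep FU gam gopen gcov.
pose c : ideal_open Z I := ideal_mkcts I (@cst_continuous X Z z1).
pose A := [set g : ideal_open Z I |
  exists U, gam U /\ forall x, ~ U x -> g x = z2].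
have /FU [u Au uc] : closure A c.
  move=> B /(ideal_open_nbhs_agree hI) [K IK KB].
  have [U gU KU] := gcov _ IK.
  have [|||g [cg gz1 gz2]] := sep (~` U) K => //.
  - by apply: open_closedC; exact: gopen.
  - by rewrite setCK.
  exists (ideal_mkcts I cg); split; first by exists U.
  by apply: KB => x Kx; exact: gz1.
have [U gU] := choice Au.
exists U => [n|K IK]; first by case: (gU n).
have cK : (c : X -> Z) @` K `<=` V by move=> _ [x _ <-].
have [m _ mK] := (ideal_open_cvgP _ _).1 uc K V IK oV cK.
exists m => n /mK /= uK x Kx; apply: contrapT => Ux.
by have [_ uz2] := gU n; apply: Vz2; rewrite -(uz2 x Ux); apply: uK; exists x.
Qed.

(** * Functions into a power and powers of the function space *)

Lemma frechet_urysohn_retract (S T : topologicalType) (e : T -> S)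
    (r : S -> T) :
  continuous e -> continuous r -> cancel e r ->
  frechet_urysohn S -> frechet_urysohn T.
Proof.
move=> ce cr er FU A a clAa.
have /FU [u Au ue] : closure (e @` A) (e a).
  by move=> B /ce /clAa [t [At Bt]]; exists (e t); split=> //; exists t.
exists (r \o u) => [n|].
  by have [t At et] := Au n; rewrite /= -et er.
rewrite -(er a); exact: (cvg_comp u r ue (cr (e a))).
Qed.

Section Power.
Variables (X Y : topologicalType) (I : set (set X)).
Local Notation PY := (prod_topology (fun _ : nat => Y)).
Local Notation CY := (ideal_open Y I).
Local Notation PC := (prod_topology (fun _ : nat => CY)).
Local Notation CP := (ideal_open PY I).

Definition tuple_map (s : PC) : CP :=
  ideal_mkcts I (@continuous_tuple X (fun=> Y) (fun x i => s i x)
    (fun i => @ideal_cts _ _ _ (s i))).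

Lemma coordinate_cts (g : CP) i : continuous (fun x => (g x : PY) i).
Proof.
move=> x; apply: (@continuous_comp _ _ _ (g : X -> PY) (fun p : PY => p i)).
  exact: ideal_cts.
exact: (@proj_continuous _ (fun=> Y) i).
Qed.

Definition coordinate_maps (g : CP) : PC :=
  fun i => ideal_mkcts I (@coordinate_cts g i).

Lemma tuple_mapK : cancel tuple_map coordinate_maps.
Proof.
by move=> s; apply/funext => i; apply/continuousEP.
Qed.

Lemma coordinate_mapsK : cancel coordinate_maps tuple_map.
Proof. by move=> g; apply/continuousEP. Qed.

Lemma coordinate_maps_continuous : continuous coordinate_maps.
Proof.
apply: continuous_tuple => i g.
have FF : Filter (coordinate_maps x i @[x --> g]).
  by apply: fmap_filter; exact: nbhs_filter.
apply/ideal_open_cvgP => K U IK oU gKU.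
have oP : open [set p : PY | U (p i)].
  by apply: (continuousP _).1 oU; exact: (@proj_continuous _ (fun=> Y) i).
have gP : (g : X -> PY) @` K `<=` [set p : PY | U (p i)].
  by move=> _ [x Kx <-]; apply: gKU; exists x.
have gg : nbhs g --> g by exact: cvg_id.
apply: filterS ((ideal_open_cvgP _ _).1 gg K _ IK oP gP) => h hP _ [x Kx <-].
by apply: (hP (h x)); exists x.
Qed.

(** Closeness at level [n] in the power involves the coordinates up to [n]
    only, hence finitely many conditions on the tuple. *)
Lemma tuple_map_continuous (E : nat -> Y -> Y -> Prop) :
  uniform_gauge E -> compact_ideal I -> continuous tuple_map.
Proof.
move=> gE hI s.
have FF : Filter (tuple_map @ s) by apply: fmap_filter; exact: nbhs_filter.
apply/(ideal_open_uniform_cvgP hI (product_gaugeP gE)) => K n IK.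
suff: forall m, nbhs s [set t : PC | forall i, (i < m)%N ->
    forall x, K x -> E n (s i x) (t i x)].
  by move=> /(_ n.+1); apply: filterS => t st x Kx i ni; exact: st.
elim=> [|m IH]; first by apply: filterS filterT => t.
have sm : nbhs s [set t : PC | forall x, K x -> E n (s m x) (t m x)].
  apply: (@proj_continuous nat (fun _ => CY) m s
            [set g : CY | forall x, K x -> E n (s m x) (g x)]).
  by apply: (ideal_open_uniform_cvgP hI gE _ _).1 => //; exact: cvg_id.
apply: filterS2 IH sm => t st stm i; rewrite ltnS leq_eqVlt => /predU1P[->//|].
exact: st.
Qed.

End Power.

(** * The equivalence *)

Lemma metrizable_separates (R : realType) (Y : topologicalType) (y1 y2 : Y) :
  metrizable R Y -> y1 <> y2 -> exists V : set Y, [/\ open V, V y1 & ~ V y2].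
Proof.
move=> [d [d0 deq dsym dtri dnbhs]] y12.
have d12 : 0 < d y1 y2.
  rewrite lt_neqAle d0 andbT; apply/eqP => h; apply: y12.
  by apply/deq.
exists (interior [set y | d y1 y < d y1 y2]); split; first exact: open_interior.
  by apply/dnbhs; exists (d y1 y2).
by move=> /interior_subset /=; rewrite ltxx.
Qed.

Theorem theorem3p4 (R : realType) (X Y : topologicalType) (I : set (set X))
    (hY : metrizable R Y) (hY2 : exists y1 y2 : Y, y1 <> y2)
    (hI : compact_ideal I) (hX : ideal_Tychonoff Y I) :
  [<-> frechet_urysohn (ideal_open Y I);
       frechet_urysohn (prod_topology (fun _ : nat => ideal_open Y I));
       frechet_urysohn (ideal_open (prod_topology (fun _ : nat => Y)) I);
       gamma_property I].
Proof.
have [E gE] := metrizable_gauge hY.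
have [y1 [y2 y12]] := hY2.
have [V [oV Vy1 Vy2]] := metrizable_separates hY y12.
have sep (A F : set X) : closed A -> I F -> F `<=` ~` A ->
    exists g : X -> Y, [/\ continuous g, forall x, F x -> g x = y1 &
      forall x, A x -> g x = y2].
  move=> cA IF FA.
  have [||g [cg gF gA]] := hX A y2 F (cst y1) cA IF FA.
  - exact: continuous_subspaceT (@cst_continuous X Y y1).
  - apply: (@sub_finite_set _ _ [set y1]) (finite_set1 _) => _ [x _ <-] //.
  by exists g; split=> // x Ax; apply: gA; exists x.
have ctuple := @tuple_map_continuous X Y I E gE hI.
have ccoord := @coordinate_maps_continuous X Y I.
tfae.
- move=> /(frechet_urysohn_gamma hI oV Vy1 Vy2 sep).
  move=> /(gamma_frechet_urysohn (product_gaugeP gE) hI).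
  exact: frechet_urysohn_retract ctuple ccoord (@tuple_mapK X Y I).
- exact: frechet_urysohn_retract ccoord ctuple (@coordinate_mapsK X Y I).
- apply: (@frechet_urysohn_gamma X (prod_topology (fun _ : nat => Y)) I
            (fun=> y1) (fun=> y2) [set p | V (p 0%N)] hI _ Vy1 Vy2 _).
    by apply: (continuousP _).1 oV; exact: (@proj_continuous _ (fun=> Y) 0%N).
  move=> A F cA IF FA; have [g [cg gF gA]] := sep A F cA IF FA.
  exists (fun x _ => g x); split=> [|x Fx|x Ax].
  + exact: (@continuous_tuple X (fun=> Y)).
  + by apply/funext => i; exact: gF.
  + by apply/funext => i; exact: gA.
- exact: gamma_frechet_urysohn gE hI.
Qed.
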